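(* Let $\mathcal A\in\mathbb R^{n\times p\times l}$ with $n\ge p$. Then $\mathcal A$ can be written as $\mathcal A=\mathcal P*\mathcal H$ with $\mathcal P\in\mathrm{St}(n,p,l)$ and $\mathcal H\in\mathbb R^{p\times p\times l}$ symmetric t-positive semidefinite, and $\mathcal H$ is unique. Furthermore, if $\mathcal A^\top*\mathcal A$ is symmetric t-positive definite, then $\mathcal P$ is unique and $\mathcal H$ is symmetric t-positive definite.
   Context: Frontal slices $A^{(i)}=\mathcal A(:,:,i)$. The t-product is $\mathcal A*\mathcal B=\operatorname{fold}(\operatorname{bcirc}(\mathcal A)\operatorname{unfold}(\mathcal B))$, where $\operatorname{bcirc}(\mathcal A)$ is the block circulant matrix with $(i,j)$ block $A^{(((i-j)\bmod l)+1)}$, $\operatorname{unfold}$ stacks frontal slices vertically, $\operatorname{fold}$ is its inverse. Transpose: $\mathcal A^\top$ has frontal slices $(A^{(1)})^\top,(A^{(l)})^\top,\dots,(A^{(2)})^\top$. $\mathcal I$ identity tensor. $\mathrm{St}(n,p,l)=\{\mathcal X\in\mathbb R^{n\times p\times l}:\mathcal X^\top*\mathcal X=\mathcal I\}$. A tensor $\mathcal H\in\mathbb R^{p\times p\times l}$ is symmetric if $\mathcal H^\top=\mathcal H$; a symmetric $\mathcal H$ is t-positive semidefinite (definite) if $\langle\mathcal Z,\mathcal H*\mathcal Z\rangle\ge0$ ($>0$) for all (nonzero) $\mathcal Z\in\mathbb R^{p\times1\times l}$, where $\langle\cdot,\cdot\rangle$ is the entrywise inner product. *)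

(* Defs.v *)
From HB Require Import structures.
From mathcomp Require Import all_boot all_order all_algebra.
Set Implicit Arguments. Unset Strict Implicit. Unset Printing Implicit Defensive.
Import Order.TTheory GRing.Theory Num.Theory.
Local Open Scope ring_scope.

(* A tensor in R^{n x p x l}: frontal slice k (0-based, k : 'I_l) is A k. *)
Definition tensor (R : Type) (n p l : nat) := {ffun 'I_l -> 'M[R]_(n, p)}.

Lemma ord_pos (l : nat) (i : 'I_l) : (0 < l)%N.
Proof. exact: leq_ltn_trans (leq0n i) (ltn_ord i). Qed.

Definition tsub (l : nat) (i j : 'I_l) : 'I_l :=
  Ordinal (ltn_pmod (i + l - j) (ord_pos i)).

Definition tneg (l : nat) (k : 'I_l) : 'I_l :=
  Ordinal (ltn_pmod (l - k) (ord_pos k)).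

Section Tensor.
Variable R : rcfType.

(* t-product: fold(bcirc(A) unfold(B)); slice i = sum_j A^((i-j) mod l) B^(j) *)
Definition tprod (n p q l : nat) (A : tensor R n p l) (B : tensor R p q l)
  : tensor R n q l :=
  [ffun i => \sum_(j < l) A (tsub i j) *m B j].

(* transpose: slices (A^(1))^T, (A^(l))^T, ..., (A^(2))^T *)
Definition ttr (n p l : nat) (A : tensor R n p l) : tensor R p n l :=
  [ffun k => (A (tneg k))^T].

Definition tid (p l : nat) : tensor R p p l :=
  [ffun k : 'I_l => if val k == 0%N then 1%:M else 0].

Definition tinner (n p l : nat) (A B : tensor R n p l) : R :=
  \sum_(k < l) \sum_(i < n) \sum_(j < p) A k i j * B k i j.

Definition tStiefel (n p l : nat) (X : tensor R n p l) : Prop :=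
  tprod (ttr X) X = tid p l.

Definition tsym (p l : nat) (H : tensor R p p l) : Prop := ttr H = H.

Definition tpsd (p l : nat) (H : tensor R p p l) : Prop :=
  tsym H /\ forall Z : tensor R p 1 l, 0 <= tinner Z (tprod H Z).

Definition tpd (p l : nat) (H : tensor R p p l) : Prop :=
  tsym H /\ forall Z : tensor R p 1 l, Z != 0 -> 0 < tinner Z (tprod H Z).

End Tensor.

(* Main.v *)
(** Under the t-product a tensor of size n x p x l is an n x p matrix over the
    commutative group algebra S of Z/l over R, the transpose being the adjoint
    for the involution of S, and the inner product is tau (tr (A^* B)) for the
    canonical trace tau of S. Positivity of this inner product forces A^* A to be
    annihilated by a product of distinct factors X - x over R with x >= 0, so
    polynomial interpolation gives the square root H and a partial isometry Q
    with A = Q H. Among extensions of Q one reaches a partial isometry whose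
    kernel projection E and cokernel projection F satisfy F X E = 0 for all X;
    since S is commutative, tr E tr F = 0, and n >= p then forces E = 0. *)
Require Import Defs.
From HB Require Import structures.
From mathcomp Require Import all_boot all_order all_algebra.
From mathcomp Require Import complex.
Import Order.TTheory GRing.Theory Num.Theory.
Local Open Scope ring_scope.
Set Implicit Arguments. Unset Strict Implicit. Unset Printing Implicit Defensive.

(** * The group algebra of a finite abelian group, its involution and trace *)

Definition group_algebra (G : finZmodType) (R : Type) := {ffun G -> R}.

HB.instance Definition _ (G : finZmodType) (R : comNzRingType) :=
  GRing.Zmodule.on (group_algebra G R).

Section GroupAlgebraRing.
Variables (G : finZmodType) (R : comNzRingType).
Local Notation S := (group_algebra G R).
Implicit Types (a b c : S) (r : R) (g : G).

(** The shift sits on the first factor, as in a circulant matrix, so that [tprod] becomes the matrix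
    product over S. *)
Definition conv a b : S := [ffun g => \sum_h a (g - h) * b h].
Definition ga_const r : S := [ffun g => if g == 0 then r else 0].

Lemma convC : commutative conv.
Proof.
move=> a b; apply/ffunP => g; rewrite !ffunE.
rewrite (reindex_inj (can_inj (subKr g))) /=.
by apply: eq_bigr => h _; rewrite subKr mulrC.
Qed.

Lemma convA : associative conv.
Proof.
move=> a b c; apply/ffunP => g; rewrite !ffunE.
under eq_bigr => h _ do rewrite ffunE mulr_sumr.
rewrite exchange_big /=; apply: eq_bigr => h _; rewrite ffunE mulr_suml.
rewrite (reindex_inj (addIr h)) /=; apply: eq_bigr => k _.
by rewrite addrK mulrA opprD addrA addrAC.
Qed.

Lemma conv_constE r a : conv (ga_const r) a = [ffun g => r * a g].
Proof.
apply/ffunP => g; rewrite !ffunE (bigD1 g) //= ffunE subrr eqxx.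
rewrite big1 ?addr0 // => h hg.
by rewrite ffunE subr_eq0 eq_sym (negPf hg) mul0r.
Qed.

Lemma conv1l : left_id (ga_const 1) conv.
Proof. by move=> a; rewrite conv_constE; apply/ffunP => g; rewrite ffunE mul1r. Qed.

Lemma convDl : left_distributive conv +%R.
Proof.
move=> a b c; apply/ffunP => g; rewrite !ffunE -big_split /=.
by apply: eq_bigr => h _; rewrite ffunE mulrDl.
Qed.

Lemma ga_const1_neq0 : ga_const 1 != 0.
Proof. by apply/eqP => /ffunP /(_ 0); rewrite !ffunE eqxx; apply/eqP/oner_neq0. Qed.

HB.instance Definition _ := GRing.Zmodule_isComNzRing.Build (group_algebra G R)
  convA convC conv1l convDl ga_const1_neq0.

Lemma ga_mulE a b g : (a * b) g = \sum_h a (g - h) * b h.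
Proof. by rewrite ffunE. Qed.

Lemma ga_constM r a g : (ga_const r * a) g = r * a g.
Proof. by rewrite [_ * _]conv_constE ffunE. Qed.

Lemma ga_const_is_additive : additive ga_const.
Proof.
move=> r s; apply/ffunP => g; rewrite !ffunE.
by case: eqP => // _; rewrite subr0.
Qed.

Lemma ga_const_is_multiplicative : multiplicative ga_const.
Proof.
split=> // r s; apply/ffunP => g; rewrite ga_constM !ffunE.
by case: eqP; rewrite ?mulr0.
Qed.

HB.instance Definition _ := GRing.isAdditive.Build R S ga_const ga_const_is_additive.
HB.instance Definition _ :=
  GRing.isMultiplicative.Build R S ga_const ga_const_is_multiplicative.

Definition star a : S := [ffun g => a (- g)].

Lemma starK : involutive star.
Proof. by move=> a; apply/ffunP => g; rewrite !ffunE opprK. Qed.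

Lemma star_is_additive : additive star.
Proof. by move=> a b; apply/ffunP => g; rewrite !ffunE. Qed.

Lemma star_const r : star (ga_const r) = ga_const r.
Proof. by apply/ffunP => g; rewrite !ffunE oppr_eq0. Qed.

Lemma star_is_multiplicative : multiplicative star.
Proof.
split=> [a b|]; last exact: star_const.
apply/ffunP => g; rewrite ffunE !ga_mulE (reindex_inj oppr_inj) /=.
by apply: eq_bigr => h _; rewrite !ffunE opprB addrC opprK.
Qed.

HB.instance Definition _ := GRing.isAdditive.Build S S star star_is_additive.
HB.instance Definition _ :=
  GRing.isMultiplicative.Build S S star star_is_multiplicative.

(* The coefficient of the neutral element is the canonical trace of the group algebra. *)
Definition tau a : R := a 0.

Lemma tau_is_additive : additive tau.
Proof. by move=> a b; rewrite /tau !ffunE. Qed.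

HB.instance Definition _ := GRing.isAdditive.Build S R tau tau_is_additive.

(** Source of all positivity below: for a = b over an ordered field this is a sum of squares. *)
Lemma tau_star_mul a b : tau (star a * b) = \sum_g a g * b g.
Proof. by rewrite /tau ga_mulE; apply: eq_bigr => g _; rewrite ffunE sub0r opprK. Qed.

Lemma tau_constM r a : tau (ga_const r * a) = r * tau a.
Proof. exact: ga_constM. Qed.

End GroupAlgebraRing.

(** * Adjoint and inner product of matrices over the group algebra *)

HB.lock Definition adj (G : finZmodType) (R : rcfType) m n
  (A : 'M[group_algebra G R]_(m, n)) : 'M[group_algebra G R]_(n, m) :=
  (map_mx (@star G R) A)^T.

Section Adjoint.
Variables (G : finZmodType) (R : rcfType).
Local Notation S := (group_algebra G R).
Local Notation iota := (@ga_const G R).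

Lemma adjE m n (A : 'M[S]_(m, n)) i j : adj A i j = star (A j i).
Proof. by rewrite adj.unlock !mxE. Qed.

Lemma adjK m n : cancel (@adj G R m n) (@adj G R n m).
Proof. by move=> A; apply/matrixP => i j; rewrite !adjE starK. Qed.

Lemma adjB m n (A B : 'M[S]_(m, n)) : adj (A - B) = adj A - adj B.
Proof. by apply/matrixP => i j; rewrite !(adjE, mxE) rmorphB. Qed.

Lemma adjD m n (A B : 'M[S]_(m, n)) : adj (A + B) = adj A + adj B.
Proof. by apply/matrixP => i j; rewrite !(adjE, mxE) rmorphD. Qed.

Lemma adj0 m n : adj (0 : 'M[S]_(m, n)) = 0.
Proof. by apply/matrixP => i j; rewrite !(adjE, mxE) rmorph0. Qed.

Lemma adjM m n p (A : 'M[S]_(m, n)) (B : 'M[S]_(n, p)) :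
  adj (A *m B) = adj B *m adj A.
Proof. by rewrite adj.unlock map_mxM trmx_mul. Qed.

Lemma adj_const n r : adj ((iota r)%:M : 'M[S]_n) = (iota r)%:M.
Proof. by rewrite adj.unlock map_scalar_mx tr_scalar_mx /= star_const. Qed.

Lemma adj1 n : adj (1%:M : 'M[S]_n) = 1%:M.
Proof. exact: adj_const. Qed.

Lemma adj_tr n (A : 'M[S]_n) : \tr (adj A) = star (\tr A).
Proof. by rewrite /mxtrace rmorph_sum; apply: eq_bigr => i _; rewrite adjE. Qed.

Definition inner m n (A B : 'M[S]_(m, n)) : R := tau (\tr (adj A *m B)).

Lemma innerE m n (A B : 'M[S]_(m, n)) :
  inner A B = \sum_j \sum_i \sum_g A i j g * B i j g.
Proof.
rewrite /inner raddf_sum /=; apply: eq_bigr => j _; rewrite mxE raddf_sum /=.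
by apply: eq_bigr => i _; rewrite adjE tau_star_mul.
Qed.

Lemma inner_ge0 m n (A : 'M[S]_(m, n)) : 0 <= inner A A.
Proof.
rewrite innerE; do 3 (apply: sumr_ge0 => ? _); exact: sqr_ge0.
Qed.

Lemma inner_eq0 m n (A : 'M[S]_(m, n)) : inner A A = 0 -> A = 0.
Proof.
rewrite innerE => H; apply/matrixP => i j; apply/ffunP => g; rewrite mxE ffunE.
have s0 x : 0 <= \sum_(i < m) \sum_h A i x h * A i x h.
  by do 2 (apply: sumr_ge0 => ? _); exact: sqr_ge0.
have /psumr_eq0P := H => /(_ (fun x _ => s0 x)) /(_ j isT).
move/psumr_eq0P => /(_ (fun x _ => sumr_ge0 _ (fun y _ => sqr_ge0 _))) /(_ i isT).
move/psumr_eq0P => /(_ (fun x _ => sqr_ge0 _)) /(_ g isT) /eqP.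
by rewrite mulf_eq0 orbb => /eqP.
Qed.

Lemma innerDr m n (A B C : 'M[S]_(m, n)) : inner A (B + C) = inner A B + inner A C.
Proof. by rewrite /inner mulmxDr mxtraceD raddfD. Qed.

Lemma inner0r m n (A : 'M[S]_(m, n)) : inner A 0 = 0.
Proof. by rewrite /inner mulmx0 mxtrace0 raddf0. Qed.

Lemma inner_constr m n (A B : 'M[S]_(m, n)) r :
  inner A ((iota r)%:M *m B) = r * inner A B.
Proof.
by rewrite /inner mul_scalar_mx -scalemxAr mxtraceZ tau_constM.
Qed.

Lemma inner_mull m n p (A : 'M[S]_(m, n)) (B : 'M[S]_(n, p)) C :
  inner (A *m B) C = inner B (adj A *m C).
Proof. by rewrite /inner adjM mulmxA. Qed.

(** Definiteness of the inner product, in the form used to prove matrix identities: a matrix with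
    zero Gram matrix is zero. *)
Lemma adj_mul_eq0 m n (A : 'M[S]_(m, n)) : adj A *m A = 0 -> A = 0.
Proof. by move=> H; apply: inner_eq0; rewrite /inner H mxtrace0 raddf0. Qed.

End Adjoint.

(** * Real polynomials in a Gram matrix *)

Section GramCalculus.
Variables (G : finZmodType) (R : rcfType) (n p : nat).
Local Notation S := (group_algebra G R).
Local Notation iota := (@ga_const G R).
Variable T : 'M[S]_(n, p.+1).

(** The size is a successor because square matrices form a nontrivial ring only in positive size. *)
Definition gram_poly (q : {poly R}) : 'M[S]_p.+1 :=
  horner_mx (adj T *m T) (map_poly iota q).

Lemma gram_polyM q r : gram_poly (q * r) = gram_poly q *m gram_poly r.
Proof. by rewrite /gram_poly !rmorphM. Qed.

Lemma gram_polyC c : gram_poly c%:P = (iota c)%:M.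
Proof. by rewrite /gram_poly map_polyC horner_mx_C. Qed.

Lemma gram_polyX : gram_poly 'X = adj T *m T.
Proof. by rewrite /gram_poly map_polyX horner_mx_X. Qed.

Lemma gram_polyD q r : gram_poly (q + r) = gram_poly q + gram_poly r.
Proof. by rewrite /gram_poly !rmorphD. Qed.

Lemma gram_polyB q r : gram_poly (q - r) = gram_poly q - gram_poly r.
Proof. by rewrite /gram_poly rmorphB; exact: rmorphB. Qed.

Lemma gram_poly0 : gram_poly 0 = 0.
Proof. by rewrite /gram_poly !rmorph0. Qed.

Lemma gram_poly1 : gram_poly 1 = 1%:M.
Proof. by rewrite /gram_poly !rmorph1. Qed.

Lemma gram_polyMC q r : gram_poly q *m gram_poly r = gram_poly r *m gram_poly q.
Proof. by rewrite -!gram_polyM mulrC. Qed.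

Lemma adj_gram_poly q : adj (gram_poly q) = gram_poly q.
Proof.
elim/poly_ind: q => [|q c IH]; first by rewrite gram_poly0 adj0.
rewrite gram_polyD gram_polyM adjD adjM IH gram_polyC adj_const gram_polyMC.
by rewrite gram_polyX adjM adjK.
Qed.

(** Matrices over S form an R-space of dimension d, so d + 1 powers of T^* T are linearly dependent
    over R. Cayley-Hamilton would only give coefficients in S, which is not ordered. *)
Lemma gram_poly_vanishes : exists2 q, q != 0 & gram_poly q = 0.
Proof.
pose d := #|{: 'I_p.+1 * 'I_p.+1 * G}|.
pose W : 'M[R]_(d.+1, d) :=
  \matrix_(i, k) ((adj T *m T) ^+ i) (enum_val k).1.1 (enum_val k).1.2 (enum_val k).2.
have : kermx W != 0.
  by rewrite -mxrank_eq0 mxrank_ker subn_eq0 -ltnNge ltnS rank_leq_col.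
case/rowV0Pn => u /sub_kermxP uW u0.
exists (rVpoly u).
  by apply: contraNneq u0 => u0; rewrite -[u]rVpolyK u0 linear0.
apply/matrixP => i j; apply/ffunP => g; rewrite mxE ffunE.
have -> : gram_poly (rVpoly u) = \sum_(k < d.+1) (iota (u 0 k))%:M *m (adj T *m T) ^+ k.
  rewrite /gram_poly /rVpoly poly_def !rmorph_sum; apply: eq_bigr => k _.
  by rewrite valK -mul_polyC !rmorphM /= map_polyC map_polyXn horner_mx_C rmorphXn /= horner_mx_X.
move/rowP: uW => /(_ (enum_rank (i, j, g))); rewrite !mxE => <-.
rewrite summxE sum_ffunE; apply: eq_bigr => k _.
by rewrite mul_scalar_mx mxE ga_constM mxE enum_rankK.
Qed.

Lemma gram_inner m (Y : 'M[S]_(p.+1, m)) :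
  inner Y (adj T *m T *m Y) = inner (T *m Y) (T *m Y).
Proof. by rewrite inner_mull mulmxA. Qed.

(** Pairing with Y gives |T Y|^2 + (- a) |Y|^2 = 0, a sum of nonnegative terms. *)
Lemma gram_no_neg_root m (Y : 'M[S]_(p.+1, m)) a :
  a < 0 -> gram_poly ('X - a%:P) *m Y = 0 -> Y = 0.
Proof.
move=> a0 /(congr1 (inner Y)); rewrite inner0r -polyCN gram_polyD gram_polyX gram_polyC.
rewrite mulmxDl innerDr gram_inner inner_constr => /eqP.
have NY : 0 <= - a * inner Y Y by rewrite mulr_ge0 ?inner_ge0 // oppr_ge0 ltW.
rewrite paddr_eq0 ?inner_ge0 // mulf_eq0 oppr_eq0 (lt_eqF a0) /= => /andP[_ /eqP].
exact: inner_eq0.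
Qed.

(** With M = T^* T, pairing with Y gives |(M - a) Y|^2 + b^2 |Y|^2 = 0. *)
Lemma gram_no_complex_root m (Y : 'M[S]_(p.+1, m)) a b :
  b != 0 -> gram_poly (('X - a%:P) ^+ 2 + (b ^+ 2)%:P) *m Y = 0 -> Y = 0.
Proof.
move=> b0 /(congr1 (inner Y)); rewrite inner0r gram_polyD expr2 gram_polyM gram_polyC.
rewrite mulmxDl innerDr inner_constr -mulmxA -{1}(adj_gram_poly ('X - _)) -inner_mull.
have bY : 0 <= b ^+ 2 * inner Y Y by rewrite mulr_ge0 ?sqr_ge0 ?inner_ge0.
move/eqP; rewrite paddr_eq0 ?inner_ge0 //.
by rewrite mulf_eq0 expf_eq0 (negPf b0) /= => /andP[_ /eqP/inner_eq0].
Qed.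

Lemma gram_reduced_root m (Y : 'M[S]_(p.+1, m)) a :
  gram_poly ('X - a%:P) *m (gram_poly ('X - a%:P) *m Y) = 0 ->
  gram_poly ('X - a%:P) *m Y = 0.
Proof.
move=> H; apply: adj_mul_eq0.
by rewrite adjM adj_gram_poly -mulmxA H mulmx0.
Qed.

End GramCalculus.


(** * An annihilating polynomial with simple nonnegative roots *)

Lemma real_poly_factor (R : rcfType) (q : {poly R}) : (1 < size q)%N ->
  (exists a, ('X - a%:P) %| q) \/
  (exists a b, b != 0 /\ (('X - a%:P) ^+ 2 + (b ^+ 2)%:P) %| q).
Proof.
move=> sq; pose f := real_complex R.
have : size (map_poly f q) != 1%N by rewrite size_map_poly; case: (size q) sq => [|[]].
(* The complex numbers over a real closed field are algebraically closed. *)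
case/closed_rootP => -[a b] rz.
have [b0|b0] := eqVneq b 0.
  left; exists a; rewrite dvdp_XsubCl -(fmorph_root f).
  by move: rz; rewrite b0.
right; exists a, b; split => //; set d := (_ + _).
have sX : size (('X - a%:P) ^+ 2) = 3%N by rewrite size_exp_XsubC.
have sd : size d = 3%N.
  by rewrite size_polyDl sX // size_polyC; case: (_ == _).
have d0 : d != 0 by rewrite -size_poly_eq0 sd.
have dz : (map_poly f d).[(a +i* b)%C] = 0.
  rewrite /d rmorphD rmorphXn rmorphB /= !map_polyC map_polyX !hornerE /= /f.
  by apply/eqP; rewrite eq_complex /=; simpc; rewrite addNr eqxx.
(* The remainder is affine with real coefficients and vanishes at a + ib: the imaginary part forces
   its slope to be 0, then the real part its constant term. *)
rewrite /dvdp; set r := (q %% d).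
have sr : (size r < 3)%N by rewrite -sd ltn_modp.
have rE : r = (r`_0)%:P + (r`_1)%:P * 'X.
  apply/polyP => -[|[|i]]; rewrite !coefE ?mulr0 ?mulr1 ?addr0 ?add0r //=.
  by apply: nth_default; apply: leq_trans (ltnSE sr) _.
have : (map_poly f r).[(a +i* b)%C] = 0.
  move/eqP: rz; rewrite [X in map_poly f X](divp_eq q d) rmorphD rmorphM hornerD hornerM.
  by rewrite dz mulr0 add0r.
rewrite rE rmorphD /= rmorphM /= !map_polyC map_polyX !hornerE /= /f => /eqP.
rewrite eq_complex /= => /andP[/eqP H1 /eqP H2].
have r1 : r`_1 = 0.
  move/eqP: H2; rewrite add0r mul0r addr0 mulf_eq0 (negPf b0) orbF.
  by move/eqP.
by move: H1; rewrite r1 !mul0r subr0 addr0 => ->; rewrite !polyC0 ?simp ?mul0r ?addr0 ?eqxx.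
Qed.

Section GramSpectrum.
Variables (G : finZmodType) (R : rcfType) (n p : nat).
Local Notation S := (group_algebra G R).
Local Notation iota := (@ga_const G R).
Variable T : 'M[S]_(n, p.+1).
Local Notation gram_poly := (gram_poly T).

(** Induction on the degree, one factor of q at a time, absorbed into Y; hence Y is arbitrary.
    Nonnegative roots are kept, while factors with a negative root or a nonreal pair are injective
    and cancel. *)
Lemma gram_poly_kill m (q : {poly R}) (Y : 'M[S]_(p.+1, m)) :
  q != 0 -> gram_poly q *m Y = 0 ->
  exists2 s : seq R, all (Num.le 0) s &
    gram_poly (\prod_(x <- s) ('X - x%:P)) *m Y = 0.
Proof.
elim: {q}(size q) {-2}q (leqnn (size q)) m Y => [|k IH] q sq m Y q0.
  by move: sq; rewrite leqn0 size_poly_eq0 (negPf q0).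
have [/real_poly_factor [[a]|[a [b [b0]]]]|] := ltnP 1 (size q).
- case/dvdpP => r qE; rewrite qE gram_polyM -mulmxA => /IH.
  have r0 : r != 0 by apply: contraNneq q0 => r0; rewrite qE r0 mul0r.
  case=> //; first by move: sq; rewrite qE size_Mmonic ?monicXsubC // size_XsubC addn2.
  move=> s s0; rewrite mulmxA gram_polyMC -mulmxA.
  have [a0|a0] := leP 0 a; last by move/(gram_no_neg_root a0); exists s.
  by exists (a :: s); rewrite /= ?a0 // big_cons gram_polyM -mulmxA.
- set d := (_ + _) => /dvdpP[r qE]; rewrite qE gram_polyM -mulmxA => /IH.
  have r0 : r != 0 by apply: contraNneq q0 => r0; rewrite qE r0 mul0r.
  have sd : size d = 3%N.
    by rewrite size_polyDl size_exp_XsubC // size_polyC; case: (_ == _).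
  have d0 : d != 0 by rewrite -size_poly_eq0 sd.
  case=> //; first by move: sq; rewrite qE size_mul // sd addn3 /= => /ltnW.
  move=> s s0; rewrite mulmxA gram_polyMC -mulmxA => /(gram_no_complex_root b0) H.
  by exists s.
- move/size1_polyC => qE; rewrite qE gram_polyC => /(congr1 (mulmx (iota (q`_0)^-1)%:M)).
  have c0 : q`_0 != 0 by apply: contraNneq q0 => c0; rewrite qE c0.
  rewrite mulmxA -scalar_mxM -rmorphM mulVf // mulmx0 rmorph1 mul1mx => ->.
  by exists [::]; rewrite ?mulmx0.
Qed.

Lemma gram_poly_undup m (s : seq R) (Y : 'M[S]_(p.+1, m)) :
  gram_poly (\prod_(x <- s) ('X - x%:P)) *m Y = 0 ->
  gram_poly (\prod_(x <- undup s) ('X - x%:P)) *m Y = 0.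
Proof.
elim: s m Y => [//|x s IH] m Y; rewrite [undup _]/= big_cons.
case: ifP => [xs|_]; last first.
  by rewrite big_cons ![('X - _) * _]mulrC !gram_polyM -!mulmxA => /IH.
move=> H; apply: IH; move: H.
rewrite (perm_big _ (perm_to_rem xs)) big_cons !gram_polyM -!mulmxA.
exact: gram_reduced_root.
Qed.

Lemma gram_spectrum : exists s : seq R, [/\ uniq s, all (Num.le 0) s &
  gram_poly (\prod_(x <- s) ('X - x%:P)) = 0].
Proof.
have [q q0 qM] := gram_poly_vanishes T.
have [|s s0 H] := @gram_poly_kill _ q 1%:M q0; first by rewrite qM mul0mx.
exists (undup s); split; first exact: undup_uniq.
  by apply/allP => x; rewrite mem_undup; move/allP: s0; apply.
by rewrite -[LHS]mulmx1; apply: gram_poly_undup.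
Qed.

End GramSpectrum.

(** * Square root and polar form by interpolation on the spectrum *)

Lemma poly_interpolation (F : fieldType) (s : seq F) (f : F -> F) :
  uniq s -> exists q : {poly F}, {in s, forall x, q.[x] = f x}.
Proof.
elim: s => [|x s IH] /=; first by exists 0.
case/andP => xs /IH[q qs]; pose d := \prod_(y <- s) ('X - y%:P).
have dx : d.[x] != 0 by rewrite -[_ == _]/(root d x) root_prod_XsubC.
(* Newton's step: the correction vanishes at the earlier nodes. *)
exists (q + ((f x - q.[x]) / d.[x]) *: d) => y; rewrite inE !hornerE.
case: eqP => [-> _|_ ys]; first by rewrite divfK // addrC subrK.
have /eqP-> : root d y by rewrite root_prod_XsubC.
by rewrite mulr0 addr0 qs.
Qed.

(* With M = T^* T, take K = g(M) and B = r(M) where g(x) = x^(-1/2), with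
   g(0) = 0, and r(x) = x^(1/4) on the spectrum of M. *)
Lemma gram_polar (G : finZmodType) (R : rcfType) n p
    (T : 'M[group_algebra G R]_(n, p)) :
  exists K B : 'M_p, let H := adj B *m B in let E := adj (T *m K) *m (T *m K) in
  [/\ H *m H = adj T *m T, T = T *m K *m H, E *m H = H & E *m E = E /\
   forall C, T *m C = T -> K *m C = K].
Proof.
case: p T => [|p] T.
  have flat m (A B : 'M[group_algebra G R]_(m, 0)) : A = B.
    by rewrite [A]thinmx0 [B]thinmx0.
  by exists 0, 0; do !split=> *; apply: flat.
have [s [us s0 sM]] := gram_spectrum T.
pose sq := Num.sqrt : R -> R.
have [g gE] := poly_interpolation (fun x => (sq x)^-1) us.
have [r rE] := poly_interpolation (fun x => sq (sq x)) us.
(* Polynomials agreeing on s differ by a multiple of the annihilator, so the claims reduce to scalar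
   identities on s. *)
have eqM q1 q2 : {in s, forall x, q1.[x] = q2.[x]} -> gram_poly T q1 = gram_poly T q2.
  move=> q12; have /dvdpP[q] : \prod_(x <- s) ('X - x%:P) %| q1 - q2.
    apply: uniq_roots_dvdp; last by rewrite uniq_rootsE.
    by apply/allP => x xs; rewrite rootE !hornerE q12 // subrr.
  move/(congr1 (gram_poly T)); rewrite gram_polyB gram_polyM sM mulmx0.
  by move/eqP; rewrite subr_eq0 => /eqP.
have sqr x : x \in s -> sq x * sq x = x.
  by move=> xs; rewrite -expr2 sqr_sqrtr //; apply: (allP s0).
have ssqr x : sq (sq x) * sq (sq x) = sq x by rewrite -expr2 sqr_sqrtr // sqrtr_ge0.
(* Holds at x = 0 too, thanks to the convention that 0 has inverse 0. *)
have sV x : sq x * (sq x)^-1 * sq x = sq x.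
  by have [->|z] := eqVneq (sq x) 0; rewrite ?mul0r // divff // mul1r.
exists (gram_poly T g), (gram_poly T r) => H E.
have HE : H = gram_poly T (r * r) by rewrite /H adj_gram_poly gram_polyM.
have EE : E = gram_poly T (g * 'X * g).
  by rewrite /E adjM adj_gram_poly !gram_polyM gram_polyX !mulmxA.
have rr x : x \in s -> (r * r).[x] = sq x by move=> xs; rewrite hornerM rE.
have gg x : x \in s -> (g * 'X * g).[x] = sq x * (sq x)^-1.
  move=> xs; rewrite !hornerE gE // -[X in _ * X * _]sqr //.
  by rewrite mulrA (mulrC _^-1) sV.
split.
- rewrite HE -gram_polyM -gram_polyX; apply: eqM => x xs.
  by rewrite hornerM rr // hornerX sqr.
(* T (1 - K H) = 0 follows from T^* T (1 - K H) = 0, that is, x (1 - x^(-1/2) x^(1/2)) = 0 on s. *)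
- apply/eqP; rewrite -subr_eq0 -mulmxA -[X in X - _]mulmx1 -mulmxBr.
  apply/eqP/adj_mul_eq0; rewrite adjM -mulmxA (mulmxA (adj T)).
  rewrite -gram_polyX HE -gram_polyM -(gram_poly1 T) -gram_polyB.
  rewrite -gram_polyM [X in _ *m X](_ : _ = 0) ?mulmx0 // -(gram_poly0 T).
  apply: eqM => x xs; rewrite hornerM hornerD hornerN hornerM rr // gE // hornerX !hornerE.
  rewrite -[X in X * _]sqr // mulrBr mulr1 -mulrA (mulrA (sq x) _ (sq x)) sV.
  exact: subrr.
- rewrite EE HE -gram_polyM; apply: eqM => x xs.
  by rewrite hornerM gg // rr // sV.
split.
  rewrite EE -gram_polyM; apply: eqM => x xs.
  by rewrite hornerM gg // mulrA sV.
(* On s, g = g^3 x, so K ends in the factor T and absorbs whatever T absorbs on the right. *)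
move=> C TC; have -> : gram_poly T g = gram_poly T (g * g * g * 'X).
  apply: eqM => x xs; rewrite !hornerE gE // -[X in _ = _ * X](sqr x xs) !mulrA.
  by have [->|u0] := eqVneq (sq x) 0; rewrite ?invr0 ?mul0r // !divfK.
by rewrite gram_polyM gram_polyX -!mulmxA TC.
Qed.

(** * Partial isometries and their extension to isometries *)

HB.lock Definition ker_proj (G : finZmodType) (R : rcfType) n p
  (Q : 'M[group_algebra G R]_(n, p)) : 'M[group_algebra G R]_p := 1%:M - adj Q *m Q.
HB.lock Definition coker_proj (G : finZmodType) (R : rcfType) n p
  (Q : 'M[group_algebra G R]_(n, p)) : 'M[group_algebra G R]_n := 1%:M - Q *m adj Q.

Section PartialIsometry.
Variables (G : finZmodType) (R : rcfType) (n p : nat).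
Local Notation S := (group_algebra G R).
Implicit Types Q V : 'M[S]_(n, p).

Definition partial_isometry Q := Q *m adj Q *m Q = Q.

Lemma ker_projE Q : ker_proj Q = 1%:M - adj Q *m Q.
Proof. by rewrite ker_proj.unlock. Qed.

Lemma coker_projE Q : coker_proj Q = 1%:M - Q *m adj Q.
Proof. by rewrite coker_proj.unlock. Qed.

(** The clauses on projections say that kernel and cokernel shrink; they let F' X E' = 0 survive
    further extensions. *)
Definition extends Q Q' := [/\ Q' *m (adj Q *m Q) = Q,
  ker_proj Q *m ker_proj Q' = ker_proj Q' &
  coker_proj Q' *m coker_proj Q = coker_proj Q'].

(** For N = 1 - Q^* Q, idempotence gives Q^* Q N = 0, so Q N has zero Gram matrix. *)
Lemma partial_isometry_of_idem Q :
  adj Q *m Q *m (adj Q *m Q) = adj Q *m Q -> partial_isometry Q.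
Proof.
move=> idem; apply/eqP; rewrite -subr_eq0 -mulmxA -[X in _ - X]mulmx1 -mulmxBr.
apply/eqP/adj_mul_eq0; rewrite adjM -mulmxA (mulmxA (adj Q)).
by rewrite mulmxBr mulmx1 idem subrr mulmx0.
Qed.

Lemma adj_ker_proj Q : adj (ker_proj Q) = ker_proj Q.
Proof. by rewrite ker_projE adjB adj1 adjM adjK. Qed.

Lemma adj_coker_proj Q : adj (coker_proj Q) = coker_proj Q.
Proof. by rewrite coker_projE adjB adj1 adjM adjK. Qed.

Lemma ker_projM Q : partial_isometry Q -> Q *m ker_proj Q = 0.
Proof. by move=> pQ; rewrite ker_projE mulmxBr mulmx1 mulmxA pQ subrr. Qed.

Lemma coker_projM Q : partial_isometry Q -> coker_proj Q *m Q = 0.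
Proof. by move=> pQ; rewrite coker_projE mulmxBl mul1mx pQ subrr. Qed.

Lemma ker_proj_idem Q : partial_isometry Q -> ker_proj Q *m ker_proj Q = ker_proj Q.
Proof. by move=> pQ; rewrite [X in X *m _]ker_projE mulmxBl mul1mx -mulmxA (ker_projM pQ) mulmx0 subr0. Qed.

Lemma coker_proj_idem Q :
  partial_isometry Q -> coker_proj Q *m coker_proj Q = coker_proj Q.
Proof.
by move=> pQ; rewrite [X in _ *m X]coker_projE mulmxBr mulmx1 mulmxA (coker_projM pQ) mul0mx subr0.
Qed.

Lemma extends_refl Q : partial_isometry Q -> extends Q Q.
Proof. by move=> pQ; split; rewrite ?mulmxA ?ker_proj_idem ?coker_proj_idem. Qed.

Lemma extends_trans Q Q' Q'' : extends Q Q' -> extends Q' Q'' -> extends Q Q''.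
Proof.
case=> e1 e2 e3 [f1 f2 f3]; split.
(* The adjoint of the kernel clause reads E' E = E', hence E' Q^* Q = 0. *)
- have qq : adj Q' *m Q' *m (adj Q *m Q) = adj Q *m Q.
    have /(congr1 (@adj _ _ _ _)) := e2; rewrite adjM !adj_ker_proj [X in _ *m X]ker_projE.
    rewrite mulmxBr mulmx1 => /eqP; rewrite -subr_eq0 addrAC subrr add0r oppr_eq0.
    by rewrite ker_projE mulmxBl mul1mx subr_eq0 eq_sym => /eqP.
  by rewrite -qq mulmxA f1 e1.
- by rewrite -f2 mulmxA e2.
- by rewrite -f3 -mulmxA e3.
Qed.

(** The last two clauses will locate V inside the kernel and cokernel of the partial isometry being
    extended. *)
Lemma gram_polar_partial_isometry (T : 'M[S]_(n, p)) : exists V H,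
  [/\ partial_isometry V, T = V *m H, adj V *m V *m H = H,
      forall C : 'M_p, T *m C = T -> V *m C = V &
      forall C : 'M_n, C *m T = T -> C *m V = V].
Proof.
have [K [B [_ TE VH [VV KE]]]] := gram_polar T.
exists (T *m K), (adj B *m B); split=> //; first exact: partial_isometry_of_idem.
  by move=> C TC; rewrite -mulmxA KE.
by move=> C CT; rewrite mulmxA CT.
Qed.

(** Add to Q the polar part V of T = F X E. As V E = V and F V = V, it is orthogonal to Q on both
    sides, so Q + V is a partial isometry with F' = F - V V^*, and F' T = T - V V^* T = 0. *)
Lemma extend_partial_isometry Q X : partial_isometry Q ->
  exists2 Q', partial_isometry Q' /\ extends Q Q' &
              coker_proj Q' *m X *m ker_proj Q' = 0.
Proof.
move=> pQ; have [T TX] : exists T, T = coker_proj Q *m X *m ker_proj Q by eexists.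
have TE : T *m ker_proj Q = T by rewrite TX -mulmxA (ker_proj_idem pQ).
have FT : coker_proj Q *m T = T by rewrite TX !mulmxA (coker_proj_idem pQ).
have [V [H [pV TV VH VC CV]]] := gram_polar_partial_isometry T.
have VE := VC _ TE; have FV := CV _ FT.
have EV : ker_proj Q *m adj V = adj V by rewrite -[X in X *m _]adj_ker_proj -adjM VE.
have VF : adj V *m coker_proj Q = adj V.
  by rewrite -[X in _ *m X]adj_coker_proj -adjM FV.
have EQ : ker_proj Q *m adj Q = 0.
  by rewrite -[_ *m _]adjK adjM adjK adj_ker_proj ker_projM // adj0.
have QF : adj Q *m coker_proj Q = 0.
  by rewrite -[_ *m _]adjK adjM adjK adj_coker_proj coker_projM // adj0.
have QV : adj Q *m V = 0 by rewrite -FV mulmxA QF mul0mx.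
have VQ : V *m adj Q = 0 by rewrite -VE -mulmxA EQ mulmx0.
have QV' : Q *m adj V = 0 by rewrite -[_ *m _]adjK adjM adjK VQ adj0.
have VQ' : adj V *m Q = 0 by rewrite -[_ *m _]adjK adjM adjK QV adj0.
have EE' : ker_proj (Q + V) = ker_proj Q - adj V *m V.
  by rewrite !ker_projE adjD mulmxDl !mulmxDr QV VQ' addr0 add0r opprD addrA.
have FF' : coker_proj (Q + V) = coker_proj Q - V *m adj V.
  by rewrite !coker_projE adjD mulmxDl !mulmxDr QV' VQ addr0 add0r opprD addrA.
have FF : coker_proj (Q + V) *m coker_proj Q = coker_proj (Q + V).
  by rewrite FF' mulmxBl (coker_proj_idem pQ) -mulmxA VF.
have EE : ker_proj Q *m ker_proj (Q + V) = ker_proj (Q + V).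
  by rewrite EE' mulmxBr (ker_proj_idem pQ) mulmxA EV.
exists (Q + V); first split.
- rewrite /partial_isometry adjD mulmxDl !mulmxDr QV' VQ addr0 add0r.
  rewrite !mulmxDl (pQ : _ = _) (pV : _ = _) -(mulmxA V) VQ' -(mulmxA Q) QV.
  by rewrite !mulmx0 addr0 add0r.
- by split=> //; rewrite mulmxDl mulmxA pQ (mulmxA V) VQ mul0mx addr0.
(* F' = F' F and E' = E E' allow X to be replaced by its compression T. *)
have -> : coker_proj (Q + V) *m X *m ker_proj (Q + V) =
          coker_proj (Q + V) *m T *m ker_proj (Q + V).
  by rewrite -[in LHS]FF -[in LHS]EE TX !mulmxA.
by rewrite FF' mulmxBl FT TV -(mulmxA V) (mulmxA (adj V)) VH subrr mul0mx.
Qed.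

Lemma extend_partial_isometry_seq Q (L : seq 'M[S]_(n, p)) : partial_isometry Q ->
  exists2 Q', partial_isometry Q' /\ extends Q Q' &
    {in L, forall X, coker_proj Q' *m X *m ker_proj Q' = 0}.
Proof.
elim: L Q => [|X L IH] Q pQ; first by exists Q => //; split=> //; exact: extends_refl.
have [Q' [pQ' eQ'] XQ'] := extend_partial_isometry X pQ.
have [Q'' [pQ'' eQ''] LQ''] := IH _ pQ'.
exists Q''; first by split=> //; exact: extends_trans eQ' eQ''.
move=> Y; rewrite inE => /predU1P[->|/LQ''//]; case: eQ'' => _ <- <-.
by rewrite mulmxA -(mulmxA _ _ X) -(mulmxA _ _ (ker_proj Q')) XQ' mulmx0 mul0mx.
Qed.

(* The hypothesis says that no nonzero map goes from the kernel of Q to the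
   kernel of its adjoint. Then tr E * tr F = 0 for the two projections E and F,
   where tr F = tr E + (n - p); applying tau to (tr E)^2 + (n - p) tr E = 0
   gives a sum of nonnegative terms, which forces E = 0. *)
Lemma maximal_partial_isometry Q : (p <= n)%N -> partial_isometry Q ->
  (forall i j, coker_proj Q *m delta_mx i j *m ker_proj Q = 0) ->
  adj Q *m Q = 1%:M.
Proof.
move=> le_pn pQ FE; set E := ker_proj Q; set F := coker_proj Q in FE *.
(* A matrix unit is a column times a row, so the (a, b) entry of F e_ij E is F_ai E_jb. *)
have FE0 a i j b : F a i * E j b = 0.
  have /matrixP/(_ a b) := FE i j; rewrite -(mul_delta_mx (0 : 'I_1)).
  by rewrite !mulmxA -colE -mulmxA -rowE !mxE big_ord1 !mxE.
have trFE : \tr F * \tr E = 0.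
  by rewrite /mxtrace mulr_suml big1 // => i _; rewrite mulr_sumr big1.
have trF : \tr F = \tr E + (n - p)%:R.
  rewrite /F /E ker_projE coker_projE !raddfB /= !mxtrace1 (mxtrace_mulC Q).
  by rewrite natrB // [RHS]addrC subrKA.
have EE : adj E *m E = E by rewrite adj_ker_proj ker_proj_idem.
have star_e : star (\tr E) = \tr E by rewrite -adj_tr adj_ker_proj.
have tauE : tau (\tr E) = inner E E by rewrite /inner EE.
have sqr_e0 : 0 <= tau (star (\tr E) * \tr E).
  by rewrite tau_star_mul; apply: sumr_ge0 => g _; exact: sqr_ge0.
move/(congr1 (@tau G R)): trFE; rewrite trF mulrDl mulr_natl raddfD raddfMn raddf0 /=.
rewrite -{1}star_e => /eqP; rewrite paddr_eq0 ?mulrn_wge0 ?tauE ?inner_ge0 //.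
case/andP; rewrite tau_star_mul => /eqP /psumr_eq0P e0 _.
(* The coefficient of tr E at the neutral element is the squared norm of E. *)
have e00 : \tr E 0 = 0.
  have /eqP := e0 (fun g _ => sqr_ge0 _) 0 isT.
  by rewrite mulf_eq0 orbb => /eqP.
have /inner_eq0/eqP : inner E E = 0 by rewrite -tauE.
by rewrite /E ker_projE subr_eq0 => /eqP.
Qed.

Lemma extend_to_isometry Q : (p <= n)%N -> partial_isometry Q ->
  exists2 P : 'M[S]_(n, p), adj P *m P = 1%:M & P *m (adj Q *m Q) = Q.
Proof.
move=> le_pn pQ.
pose L : seq 'M[S]_(n, p) := [seq delta_mx i j | i <- enum 'I_n, j <- enum 'I_p].
have [P [pP [eP _ _]] LP] := extend_partial_isometry_seq L pQ.
exists P => //; apply: maximal_partial_isometry => // i j.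
by apply: LP; apply: allpairs_f; rewrite mem_enum.
Qed.

End PartialIsometry.

(** * Polar decomposition and uniqueness of positive square roots *)

Section Polar.
Variables (G : finZmodType) (R : rcfType) (n p : nat).
Local Notation S := (group_algebra G R).

(** With Q = A K and Q^* Q H = H, an isometry P extending Q satisfies P H = P Q^* Q H = Q H = A. *)
Lemma polar_exists (A : 'M[S]_(n, p)) : (p <= n)%N ->
  exists (P : 'M[S]_(n, p)) (B : 'M_p), let H := adj B *m B in
    [/\ adj P *m P = 1%:M, A = P *m H & H *m H = adj A *m A].
Proof.
move=> le_pn; have [K [B /= [HH AE EH [EE _]]]] := gram_polar A.
have [P PP PE] := extend_to_isometry le_pn (partial_isometry_of_idem EE).
exists P, B; split=> //; by rewrite -EH mulmxA PE.
Qed.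

Definition psd (H : 'M[S]_p) :=
  adj H = H /\ forall Z : 'cV_p, 0 <= inner Z (H *m Z).

Lemma inner_cols m (A B : 'M[S]_(p, m)) :
  inner A B = \sum_j inner (col j A) (col j B).
Proof.
rewrite innerE; apply: eq_bigr => j _; rewrite innerE big_ord1.
by apply: eq_bigr => i _; rewrite !mxE.
Qed.

Lemma psd_inner_ge0 H m (X : 'M[S]_(p, m)) : psd H -> 0 <= inner X (H *m X).
Proof.
case=> _ pH; rewrite inner_cols; apply: sumr_ge0 => j _.
by rewrite !colE -mulmxA; apply: pH.
Qed.

Lemma psd_adj_mul (B : 'M[S]_p) : psd (adj B *m B).
Proof.
split=> [|Z]; first by rewrite adjM adjK.
by rewrite -mulmxA -inner_mull inner_ge0.
Qed.

(** For D = H - H0, H D + D H0 = 0. Pairing with D, by cyclicity of the trace, gives two nonnegative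
    terms with sum 0. The factored form of H0 turns the second into |B D|^2, so B D = 0; then H0 D,
    D H0 and H D vanish, hence D^* D = 0. *)
Lemma psd_sqrt_unique (H B : 'M[S]_p) : psd H ->
  H *m H = adj B *m B *m (adj B *m B) -> H = adj B *m B.
Proof.
move=> pH; set H0 := adj B *m B => HH; have [aH _] := pH.
have aH0 : adj H0 = H0 by rewrite adjM adjK.
pose D := H - H0; have aD : adj D = D by rewrite adjB aH aH0.
have HD : H *m D + D *m H0 = 0.
  by rewrite mulmxBr mulmxBl HH addrA subrK subrr.
have : inner D (H *m D) + inner D (H0 *m D) = 0.
  have -> : inner D (H0 *m D) = inner D (D *m H0).
    by rewrite /inner aD mulmxA mxtrace_mulC.
  by rewrite -innerDr HD inner0r.
have posH := psd_inner_ge0 D pH; have posH0 := psd_inner_ge0 D (psd_adj_mul B).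
move/eqP; rewrite (paddr_eq0 posH posH0) => /andP[_].
rewrite /H0 -mulmxA -inner_mull => /eqP/inner_eq0 BD.
have H0D : H0 *m D = 0 by rewrite /H0 -mulmxA BD mulmx0.
have DH0 : D *m H0 = 0 by rewrite -aD -aH0 -adjM H0D adj0.
have HD0 : H *m D = 0 by move: HD; rewrite DH0 addr0.
have /adj_mul_eq0/eqP : adj D *m D = 0 by rewrite aD {1}/D mulmxBl HD0 H0D subrr.
by rewrite subr_eq0 => /eqP.
Qed.

Lemma polar_gram (A P : 'M[S]_(n, p)) H : adj P *m P = 1%:M -> adj H = H ->
  A = P *m H -> adj A *m A = H *m H.
Proof. by move=> PP aH ->; rewrite adjM aH -mulmxA (mulmxA (adj P)) PP mul1mx. Qed.

End Polar.

(** * Translation between tensors and matrices over the group algebra of a cyclic group *)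

Section Transfer.
Variables (R : rcfType) (l : nat).
Local Notation S := (group_algebra 'I_l.+1 R).

Definition tensor_mx n p (A : tensor R n p l.+1) : 'M[S]_(n, p) :=
  \matrix_(i, j) [ffun k => A k i j].

Definition mx_tensor n p (A : 'M[S]_(n, p)) : tensor R n p l.+1 :=
  [ffun k => \matrix_(i, j) A i j k].

Lemma tensor_mxK n p : cancel (@tensor_mx n p) (@mx_tensor n p).
Proof. by move=> A; apply/ffunP => k; apply/matrixP => i j; rewrite ffunE !mxE ffunE. Qed.

Lemma mx_tensorK n p : cancel (@mx_tensor n p) (@tensor_mx n p).
Proof. by move=> A; apply/matrixP => i j; apply/ffunP => k; rewrite mxE !ffunE mxE. Qed.

Lemma tensor_mx_inj n p : injective (@tensor_mx n p).
Proof. exact: can_inj (@tensor_mxK n p). Qed.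

Lemma tsubE (i j : 'I_l.+1) : tsub i j = i - j.
(* [tsub] adds the modulus before subtracting, so the natural subtraction never truncates. *)
Proof. by apply: val_inj; rewrite /= modnDmr addnBA // ltnW. Qed.

Lemma tnegE (i : 'I_l.+1) : tneg i = - i.
Proof. exact: val_inj. Qed.

Lemma tensor_mx0 n p : tensor_mx (0 : tensor R n p l.+1) = 0.
Proof. by apply/matrixP => i j; apply/ffunP => k; rewrite !mxE !ffunE mxE. Qed.

Lemma tensor_mxM n p q (A : tensor R n p l.+1) (B : tensor R p q l.+1) :
  tensor_mx (tprod A B) = tensor_mx A *m tensor_mx B.
Proof.
apply/matrixP => i j; apply/ffunP => k; rewrite !mxE !ffunE summxE sum_ffunE.
under [RHS]eq_bigr => h _ do rewrite !mxE ga_mulE.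
rewrite exchange_big /=; apply: eq_bigr => h _; rewrite mxE.
by apply: eq_bigr => m _; rewrite !ffunE tsubE.
Qed.

Lemma tensor_mx_tr n p (A : tensor R n p l.+1) : tensor_mx (ttr A) = adj (tensor_mx A).
Proof.
by apply/matrixP => i j; apply/ffunP => k; rewrite adjE !mxE !ffunE mxE tnegE.
Qed.

Lemma tensor_mx1 p : tensor_mx (tid R p l.+1) = 1%:M.
Proof.
apply/matrixP => i j; apply/ffunP => k; rewrite !mxE !ffunE.
have [->|k0] := eqVneq k 0; first by rewrite eqxx /= mxE; case: eqP => _; rewrite !ffunE.
rewrite -[val k == 0%N]/(k == 0) (negPf k0) mxE.
by case: eqP => _; rewrite ffunE ?(negPf k0).
Qed.

Lemma tinner_mx n p (A B : tensor R n p l.+1) :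
  tinner A B = inner (tensor_mx A) (tensor_mx B).
Proof.
rewrite innerE /tinner exchange_big [RHS]exchange_big; apply: eq_bigr => i _.
rewrite exchange_big; apply: eq_bigr => j _.
by apply: eq_bigr => k _; rewrite !mxE !ffunE.
Qed.

Lemma tStiefel_mx n p (P : tensor R n p l.+1) :
  tStiefel P <-> adj (tensor_mx P) *m tensor_mx P = 1%:M.
Proof.
rewrite -tensor_mx_tr -tensor_mxM -tensor_mx1.
by split=> [->|/tensor_mx_inj].
Qed.

Lemma tsym_mx p (H : tensor R p p l.+1) : tsym H <-> adj (tensor_mx H) = tensor_mx H.
Proof. by rewrite -tensor_mx_tr; split=> [->|/tensor_mx_inj]. Qed.

Lemma tpsd_mx p (H : tensor R p p l.+1) : tpsd H <-> psd (tensor_mx H).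
Proof.
split=> -[/tsym_mx aH pH]; split=> // Z.
  by rewrite -[Z]mx_tensorK -tensor_mxM -tinner_mx.
by rewrite tinner_mx tensor_mxM.
Qed.

(** Definiteness is tested on single columns, so it is applied to each column of X. *)
Lemma tpd_mul_eq0 p m (H : tensor R p p l.+1) (X : 'M_(p, m)) :
  tpd H -> tensor_mx H *m X = 0 -> X = 0.
Proof.
case=> _ pH HX; apply/matrixP => i j.
have colX : col j X = 0.
  have [Z0|/pH] := eqVneq (mx_tensor (col j X)) 0.
    by rewrite -[LHS]mx_tensorK Z0 tensor_mx0.
  by rewrite tinner_mx tensor_mxM mx_tensorK colE mulmxA HX mul0mx inner0r ltxx.
by move/matrixP/(_ i 0): colX; rewrite !mxE.
Qed.

Lemma tpolar_exists n p (A : tensor R n p l.+1) : (p <= n)%N ->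
  exists (P : tensor R n p l.+1) (H : tensor R p p l.+1),
    tStiefel P /\ tpsd H /\ A = tprod P H.
Proof.
move=> le_pn; have [P [B /= [PP AE _]]] := polar_exists (tensor_mx A) le_pn.
exists (mx_tensor P), (mx_tensor (adj B *m B)); split; last split.
- by apply/tStiefel_mx; rewrite mx_tensorK.
- by apply/tpsd_mx; rewrite mx_tensorK; apply: psd_adj_mul.
- by apply: tensor_mx_inj; rewrite tensor_mxM !mx_tensorK.
Qed.

Lemma tpolar_gram n p (A P : tensor R n p l.+1) H :
  tStiefel P -> tpsd H -> A = tprod P H ->
  tprod (ttr A) A = tprod H H.
Proof.
move=> /tStiefel_mx PP /tpsd_mx[aH _] AE; apply: tensor_mx_inj.
rewrite !tensor_mxM tensor_mx_tr; apply: polar_gram PP aH _.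
by rewrite AE tensor_mxM.
Qed.

(** Neither root comes factored as B^* B, so both are compared with the polar factor of the
    first. *)
Lemma tpsd_sqrt_unique p (H1 H2 : tensor R p p l.+1) :
  tpsd H1 -> tpsd H2 -> tprod H1 H1 = tprod H2 H2 -> H1 = H2.
Proof.
move=> /tpsd_mx p1 /tpsd_mx p2 H12.
have [_ [B /= [_ _ HH]]] := polar_exists (tensor_mx H1) (leqnn p).
have aHH (H : tensor R p p l.+1) : psd (tensor_mx H) ->
  adj (tensor_mx H) *m tensor_mx H = tensor_mx (tprod H H).
  by case=> aH _; rewrite aH tensor_mxM.
apply: tensor_mx_inj; rewrite (psd_sqrt_unique (B := B) p1) ?HH ?aHH ?tensor_mxM //.
by rewrite (psd_sqrt_unique (B := B) p2) // HH aHH // H12 tensor_mxM.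
Qed.

(** Writing H = B^* B, a vector Z with <Z, H Z> = |B Z|^2 = 0 is killed by H, hence by the definite
    H * H. *)
Lemma tpsd_sqrt_tpd p (H : tensor R p p l.+1) : tpsd H -> tpd (tprod H H) -> tpd H.
Proof.
move=> pH pHH; have [sH pH0] := pH; split=> // Z Z0.
rewrite lt_neqAle pH0 andbT eq_sym; apply: contraNneq Z0.
have [_ [B /= [_ _ HH]]] := polar_exists (tensor_mx H) (leqnn p).
have HB : tensor_mx H = adj B *m B.
  apply: psd_sqrt_unique; first exact/tpsd_mx.
  by rewrite HH; have /tsym_mx-> := sH.
rewrite tinner_mx tensor_mxM HB -mulmxA -inner_mull => /inner_eq0 BZ.
apply/eqP/tensor_mx_inj; rewrite tensor_mx0.
by apply: tpd_mul_eq0 pHH _; rewrite tensor_mxM HB -!mulmxA BZ !mulmx0.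
Qed.

(** The adjoint of (P1 - P2) H = 0 is H (P1 - P2)^* = 0, and a definite H is injective. *)
Lemma tpolar_factor_unique n p (P1 P2 : tensor R n p l.+1) H :
  tpsd H -> tpd (tprod H H) -> tprod P1 H = tprod P2 H -> P1 = P2.
Proof.
move=> pH pHH PH; have /tpsd_mx[aH _] := pH.
have /eqP : adj (tensor_mx P1 - tensor_mx P2) = 0.
  apply: tpd_mul_eq0 (tpsd_sqrt_tpd pH pHH) _; rewrite -aH -adjM mulmxBl.
  by rewrite -!tensor_mxM PH subrr adj0.
move/eqP/(congr1 (@adj _ _ _ _)); rewrite adjK adj0 => /eqP.
by rewrite subr_eq0 => /eqP/tensor_mx_inj.
Qed.

End Transfer.

(** * The case of no slices, and the polar decomposition of tensors *)

Lemma tensor0_all_equal (R : Type) n p (A B : tensor R n p 0) : A = B.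
Proof. by apply/ffunP => -[]. Qed.

Theorem mainTheorem15 (R : rcfType) (n p l : nat) (A : tensor R n p l) :
  (p <= n)%N ->
  (exists (P : tensor R n p l) (H : tensor R p p l),
      tStiefel P /\ tpsd H /\ A = tprod P H) /\
  (forall (P1 P2 : tensor R n p l) (H1 H2 : tensor R p p l),
      tStiefel P1 -> tpsd H1 -> A = tprod P1 H1 ->
      tStiefel P2 -> tpsd H2 -> A = tprod P2 H2 -> H1 = H2) /\
  (tpd (tprod (ttr A) A) ->
   forall (P1 P2 : tensor R n p l) (H1 H2 : tensor R p p l),
      tStiefel P1 -> tpsd H1 -> A = tprod P1 H1 ->
      tStiefel P2 -> tpsd H2 -> A = tprod P2 H2 ->
      P1 = P2 /\ tpd H1).
Proof.
(* For l = 0 the indices form no group, but all tensors coincide, and definiteness is vacuous. *)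
case: l A => [|l] A le_pn.
  split; last split.
  - exists [ffun=> 0], [ffun=> 0]; split; first exact: tensor0_all_equal.
    split; last exact: tensor0_all_equal.
    by split=> [|Z]; [exact: tensor0_all_equal | rewrite /tinner big_ord0].
  - by move=> *; apply: tensor0_all_equal.
  - move=> _ P1 P2 H1 H2 *; split; first exact: tensor0_all_equal.
    split=> [|Z]; first exact: tensor0_all_equal.
    by rewrite (tensor0_all_equal Z 0) eqxx.
(* Both factors are positive semidefinite square roots of the transpose of A times A. *)
have uniqH P1 P2 H1 H2 : tStiefel P1 -> tpsd H1 -> A = tprod P1 H1 ->
    tStiefel P2 -> tpsd H2 -> A = tprod P2 H2 -> H1 = H2.
  move=> s1 h1 A1 s2 h2 A2; apply: tpsd_sqrt_unique => //.
  by rewrite -(tpolar_gram s1 h1 A1) -(tpolar_gram s2 h2 A2).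
split; first exact: tpolar_exists.
split=> // pA P1 P2 H1 H2 s1 h1 A1 s2 h2 A2.
have pHH : tpd (tprod H1 H1) by rewrite -(tpolar_gram s1 h1 A1).
split; last exact: tpsd_sqrt_tpd.
apply: (tpolar_factor_unique h1 pHH); rewrite -A1 A2.
by rewrite (uniqH _ _ _ _ s1 h1 A1 s2 h2 A2).
Qed.
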